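(* Let $\Pi$ be a (finite, nonempty) set of patterns and $k=\max_{\pi\in\Pi}|\pi|$. If permutations are represented as integers (the $i$-th letter occupying the $i$-th block of $j$ bits, for a fixed block size $j$), then the set $S_{\le n}(\Pi)$ can be constructed in time $O(|S_{\le n-1}(\Pi)|\cdot nk)$.
   Context: A permutation in $S_n$ is a word containing each of $1,\dots,n$ exactly once; $S_{\le n}=S_1\cup\dots\cup S_n$. For $\pi\in S_k$ and $\tau\in S_n$, a $\pi$-hit in $\tau$ is a $k$-letter subsequence of $\tau$ order-isomorphic to $\pi$; $\tau$ avoids $\Pi$ if it has no $\pi$-hit for any $\pi\in\Pi$; $S_n(\Pi)$ (resp. $S_{\le n}(\Pi)$) is the set of permutations in $S_n$ (resp. $S_{\le n}$) avoiding $\Pi$. Model of computation: a word RAM in which each permutation considered (of length at most $n$, with letters encoded in fixed-width bit blocks) fits in a constant number of machine words, standard integer operations (addition, multiplication, bitwise and/or, bit shifts, modular reduction by powers of two) take constant time, and hash tables keyed by such integers support insertion and membership queries in constant time. *)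

(* Defs.v *)
From mathcomp Require Import all_boot.

Set Implicit Arguments.
Unset Strict Implicit.
Unset Printing Implicit Defensive.

(** * Permutations and pattern avoidance *)

(** A permutation of length [m] is a word, as a [seq nat], over the letters
    [1 .. m]. *)
Definition is_permutation (s : seq nat) : bool :=
  (0 < size s) && perm_eq s (iota 1 (size s)).

Definition order_iso (s t : seq nat) : bool :=
  (size s == size t) &&
  [forall a : 'I_(size s), forall b : 'I_(size s),
     (nth 0 s a < nth 0 s b) == (nth 0 t a < nth 0 t b)].

(** The subsequences of [t] are the words [mask m t]. *)
Definition contains (p t : seq nat) : bool :=
  [exists m : (size t).-tuple bool, order_iso (mask m t) p].

Definition avoids (Pi : seq (seq nat)) (t : seq nat) : bool :=
  all (fun p => ~~ contains p t) Pi.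

Definition avoiders (Pi : seq (seq nat)) (m : nat) : seq (seq nat) :=
  [seq t <- permutations (iota 1 m) | avoids Pi t].

Definition avoiders_le (Pi : seq (seq nat)) (n : nat) : seq (seq nat) :=
  flatten [seq avoiders Pi m | m <- iota 1 n].

Definition max_length (Pi : seq (seq nat)) : nat := \max_(p <- Pi) size p.

(** The blocks of [j] bits are numbered from the least significant one. *)
Definition encode (j : nat) (s : seq nat) : nat :=
  \sum_(i < size s) nth 0 s i * 2 ^ (j * i).

(** * Word RAM with hash tables

    A program is a fixed finite text.  It addresses finitely many registers,
    arrays and hash tables by constant names; array cells are indexed by words
    computed at run time.  Words are the integers below [2 ^ w]. *)

Inductive operand := Reg of nat | Lit of nat.

Inductive binop := Add | Sub | Mul | And | Or | Shl | Shr | ModPow2.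

Inductive cmpop := CEq | CLt.

Inductive cmd :=
  | Skip
  | Then of cmd & cmd
  | Move of nat & operand                     (* r := x *)
  | Op of nat & binop & operand & operand     (* r := x o y *)
  | Read of nat & nat & operand               (* r := A[x] *)
  | Write of nat & operand & operand          (* A[x] := y *)
  | Insert of nat & operand                   (* add x to the table H *)
  | Member of nat & nat & operand             (* r := (x is in the table H) *)
  | If of cmpop & operand & operand & cmd & cmd
  | While of cmpop & operand & operand & cmd.

Record state := State {
  regs : nat -> nat;
  arrays : nat -> nat -> nat;
  tables : nat -> pred nat
}.

Definition upd (A : Type) (f : nat -> A) (i : nat) (v : A) : nat -> A :=
  fun i' => if i' == i then v else f i'.

Definition set_reg (s : state) (r v : nat) : state :=
  State (upd (regs s) r v) (arrays s) (tables s).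

Definition set_cell (s : state) (A x v : nat) : state :=
  State (regs s) (upd (arrays s) A (upd (arrays s A) x v)) (tables s).

Definition add_key (s : state) (H x : nat) : state :=
  State (regs s) (arrays s) (upd (tables s) H (upd (tables s H) x true)).

Definition oval (w : nat) (s : state) (x : operand) : nat :=
  match x with Reg r => regs s r | Lit c => c %% 2 ^ w end.

Definition binop_val (w : nat) (o : binop) (a b : nat) : nat :=
  match o with
  | Add => (a + b) %% 2 ^ w
  | Sub => (a + (2 ^ w - b)) %% 2 ^ w
  | Mul => (a * b) %% 2 ^ w
  | And => Nat.land a b
  | Or => Nat.lor a b
  | Shl => (a * 2 ^ b) %% 2 ^ w
  | Shr => a %/ 2 ^ b
  | ModPow2 => a %% 2 ^ b
  end.

Definition test (w : nat) (s : state) (c : cmpop) (x y : operand) : bool :=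
  match c with
  | CEq => oval w s x == oval w s y
  | CLt => oval w s x < oval w s y
  end.

(** [exec w c s t s']: run from [s], the program [c] halts in [s'] after [t]
    steps; every elementary instruction and every test is one step. *)
Inductive exec (w : nat) : cmd -> state -> nat -> state -> Prop :=
  | exec_skip s : exec w Skip s 0 s
  | exec_then c1 c2 s t1 s1 t2 s2 :
      exec w c1 s t1 s1 -> exec w c2 s1 t2 s2 -> exec w (Then c1 c2) s (t1 + t2) s2
  | exec_move r x s : exec w (Move r x) s 1 (set_reg s r (oval w s x))
  | exec_op r o x y s :
      exec w (Op r o x y) s 1 (set_reg s r (binop_val w o (oval w s x) (oval w s y)))
  | exec_read r A x s :
      exec w (Read r A x) s 1 (set_reg s r (arrays s A (oval w s x)))
  | exec_write A x y s :
      exec w (Write A x y) s 1 (set_cell s A (oval w s x) (oval w s y))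
  | exec_insert H x s : exec w (Insert H x) s 1 (add_key s H (oval w s x))
  | exec_member r H x s :
      exec w (Member r H x) s 1 (set_reg s r (tables s H (oval w s x)))
  | exec_if c x y c1 c2 s t s' :
      exec w (if test w s c x y then c1 else c2) s t s' ->
      exec w (If c x y c1 c2) s t.+1 s'
  | exec_while_false c x y c1 s :
      ~~ test w s c x y -> exec w (While c x y c1) s 1 s
  | exec_while_true c x y c1 s t1 s1 t2 s2 :
      test w s c x y -> exec w c1 s t1 s1 -> exec w (While c x y c1) s1 t2 s2 ->
      exec w (While c x y c1) s (t1 + t2).+1 s2.

(** Input: [n], [k] and [j] are in registers 0, 1 and 2, and table 0 is the hash
    table of the encoded patterns; everything else is zero or empty. *)
Definition input_state (Pi : seq (seq nat)) (n j : nat) : state :=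
  State (nth 0 [:: n; max_length Pi; j])
        (fun _ _ => 0)
        (fun H x => (H == 0) && (x \in [seq encode j p | p <- Pi])).

(** Output: array 0, whose length is in register 0. *)
Definition output (s : state) : seq nat := mkseq (arrays s 0) (regs s 0).

(* Main.v *)
Require Import Defs.
From mathcomp Require Import all_boot zify.

(** The avoiders are generated by length in a queue, their codes being kept in
    a hash table.  Let [s] be an avoider of length [m] and let [t] arise from
    [s] by inserting the letter [m + 1].  A hit in [t] of a pattern of length at
    most [k] is either all of [t], or it uses [m + 1] and misses one of the
    [min(k, m)] letters just below it; hence [t] avoids [Pi] iff [t] is not in
    [Pi] and deleting any of these letters from [t] leaves an avoider of length
    [m], which is a table lookup.  The positions of the letters of [s] are
    tabulated once per [s], and when the deleted letter goes from [v] to [v - 1]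
    the renormalised code changes by one subtraction, so each lookup costs
    [O(1)], each of the [m + 1] words [t] costs [O(k)], and each [s] costs
    [O(n k)]. *)

Set Implicit Arguments.
Unset Strict Implicit.
Unset Printing Implicit Defensive.

(** * Pattern containment *)

Lemma order_isoP (s t : seq nat) :
  reflect (size s = size t /\
           forall a b, a < size s -> b < size s ->
             (nth 0 s a < nth 0 s b) = (nth 0 t a < nth 0 t b))
          (order_iso s t).
Proof.
apply: (iffP andP) => -[/eqP sz H]; split=> //.
- move=> a b ha hb; move/forallP/(_ (Ordinal ha))/forallP/(_ (Ordinal hb)): H.
  by move/eqP.
- by apply/forallP=> a; apply/forallP=> b; rewrite H.
Qed.

Lemma containsP (p t : seq nat) :
  reflect (exists2 u : seq nat, subseq u t & order_iso u p) (contains p t).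
Proof.
apply: (iffP existsP) => [[m Hm]|[u /subseqP [m sm ->] Hu]].
  by exists (mask m t) => //; apply: mask_subseq.
have szm : size m == size t by apply/eqP.
by exists (Tuple szm).
Qed.

Lemma order_iso_map (f : nat -> nat) (u p : seq nat) :
  {in u &, {mono f : x y / x < y}} -> order_iso (map f u) p = order_iso u p.
Proof.
move=> mf; apply/order_isoP/order_isoP; rewrite size_map => -[sz H]; split=> //.
  move=> a b ha hb; rewrite -H // !(nth_map 0) // mf //; exact: mem_nth.
move=> a b ha hb; rewrite -H // !(nth_map 0) // mf //; exact: mem_nth.
Qed.

(** Only comparisons of letters matter for hits, so renormalising a word after a deletion does not
    change which patterns it contains. *)
Lemma contains_map (f : nat -> nat) (t p : seq nat) :
  {in t &, {mono f : x y / x < y}} -> contains p (map f t) = contains p t.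
Proof.
move=> mf.
have mfu u : subseq u t -> {in u &, {mono f : x y / x < y}}.
  by move=> /mem_subseq sut x y hx hy; apply: mf; apply: sut.
apply/containsP/containsP => -[u su Hu].
  case/subseqP: su => m; rewrite size_map => sm eu; move: Hu; rewrite eu -map_mask.
  rewrite order_iso_map; last by apply: mfu; apply: mask_subseq.
  by exists (mask m t) => //; apply: mask_subseq.
exists (map f u); first exact: map_subseq.
by rewrite order_iso_map //; apply: mfu.
Qed.

Lemma contains_subseq (p s t : seq nat) : subseq s t -> contains p s -> contains p t.
Proof.
move=> st /containsP [u us Hu]; apply/containsP; exists u => //.
exact: subseq_trans us st.
Qed.

Lemma perm_iota_mem m (t : seq nat) x :
  perm_eq t (iota 1 m) -> (x \in t) = (0 < x <= m).
Proof. by move/perm_mem=> ->; rewrite mem_iota add1n ltnS. Qed.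

Lemma perm_iota_size m (t : seq nat) : perm_eq t (iota 1 m) -> size t = m.
Proof. by move/perm_size; rewrite size_iota. Qed.

Lemma perm_iota_uniq m (t : seq nat) : perm_eq t (iota 1 m) -> uniq t.
Proof. by move/perm_uniq=> ->; rewrite iota_uniq. Qed.

(** The letters below [v] in a permutation are exactly [1 .. v - 1]. Hence each letter can be read
    off from comparisons alone. *)
Lemma permutation_letter m (t : seq nat) i :
  perm_eq t (iota 1 m) -> i < m ->
  nth 0 t i = (count (fun x => x < nth 0 t i) t).+1.
Proof.
move=> pt im; set v := nth 0 t i.
have : v \in t by apply: mem_nth; rewrite (perm_iota_size pt).
rewrite (perm_iota_mem _ pt) => /andP [v0 vm].
rewrite (permP pt) -[m in iota _ m](subnKC (leq_trans (leq_pred v) vm)) iotaD count_cat.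
rewrite (_ : count _ (iota 1 v.-1) = size (iota 1 v.-1)); last first.
  by apply/eqP; rewrite -all_count; apply/allP=> x; rewrite mem_iota; lia.
rewrite size_iota (_ : count _ _ = 0) ?addn0 ?prednK //.
by apply/eqP; rewrite -leqn0 leqNgt -has_count; apply/hasPn=> x; rewrite mem_iota; lia.
Qed.

Lemma order_iso_permutation m (s t : seq nat) :
  perm_eq s (iota 1 m) -> perm_eq t (iota 1 m) -> order_iso s t -> s = t.
Proof.
move=> ps pt /order_isoP [sz H].
have szm := perm_iota_size ps.
apply: (@eq_from_nth _ 0) => // i; rewrite szm => im.
rewrite (permutation_letter ps im) (permutation_letter pt im); congr _.+1.
have countE (a : pred nat) r :
    count a r = count (fun i => a (nth 0 r i)) (iota 0 (size r)).
  by rewrite -[in LHS](mkseq_nth 0 r) count_map.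
rewrite (countE _ s) (countE _ t) -sz.
apply: eq_in_count => a; rewrite mem_iota add0n => /andP [_ ha] /=.
by apply: H => //; rewrite szm.
Qed.

(** * Deleting a letter and inserting a new maximum *)

(** Kept apart from [del] because the program maintains the code of [lower v t], where the letter
    [v] is still in place, and cuts out its block only for the lookup. *)
Definition lower (v : nat) (t : seq nat) : seq nat := [seq x - (v < x) | x <- t].

Definition del (v : nat) (t : seq nat) : seq nat := lower v (filter (predC1 v) t).

Definition ins (p a : nat) (s : seq nat) : seq nat := take p s ++ a :: drop p s.

Lemma contains_del v p t : contains p (del v t) = contains p (filter (predC1 v) t).
Proof.
apply: contains_map => x y; rewrite !mem_filter /= => /andP [xv _] /andP [yv _].
by lia.
Qed.

Lemma del_permutation m v t :
  0 < v <= m.+1 -> perm_eq t (iota 1 m.+1) -> perm_eq (del v t) (iota 1 m).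
Proof.
move=> hv pt; apply: uniq_perm; rewrite ?iota_uniq //.
  rewrite map_inj_in_uniq ?filter_uniq ?(perm_iota_uniq pt) // => x y.
  by rewrite !mem_filter /= !(perm_iota_mem _ pt) => /andP [? ?] /andP [? ?]; lia.
move=> x; rewrite mem_iota; apply/mapP/idP.
  by case=> y; rewrite mem_filter /= (perm_iota_mem _ pt) => /andP [? ?]; lia.
(* The preimage of [x] is found by reopening the gap at [v]. *)
move=> hx; exists (x + (v <= x)); last by lia.
by rewrite mem_filter /= (perm_iota_mem _ pt); lia.
Qed.

Lemma ins_perm p a s : perm_eq (ins p a s) (a :: s).
Proof. by rewrite perm_catC /= perm_cons perm_catC cat_take_drop. Qed.

Lemma ins_permutation m p s :
  perm_eq s (iota 1 m) -> perm_eq (ins p m.+1 s) (iota 1 m.+1).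
Proof.
move=> ps; apply: perm_trans (ins_perm _ _ _) _.
rewrite -(addn1 m) iotaD add1n addn1 perm_sym perm_catC perm_cons.
by rewrite perm_sym.
Qed.

Lemma filter_ins p a s : a \notin s -> filter (predC1 a) (ins p a s) = s.
Proof.
move=> as_; rewrite filter_cat /= eqxx -filter_cat cat_take_drop.
by apply/all_filterP/allP=> x xs /=; apply: contraNneq as_ => <-.
Qed.

Lemma index_ins p a s : a \notin s -> p <= size s -> index a (ins p a s) = p.
Proof.
move=> as_ ps; rewrite index_cat.
rewrite (negPf (contra (@mem_take p _ s a) as_)) /= eqxx addn0.
by rewrite size_take_min; apply/minn_idPl.
Qed.

Lemma permutation_max_notin m s : perm_eq s (iota 1 m) -> m.+1 \notin s.
Proof. by move=> ps; rewrite (perm_iota_mem _ ps); lia. Qed.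

Lemma avoids_subseq Pi s t : subseq s t -> avoids Pi t -> avoids Pi s.
Proof.
move=> st /allP H; apply/allP=> p /H; apply: contra; exact: contains_subseq.
Qed.

Lemma avoids_del Pi v t : avoids Pi (del v t) = avoids Pi (filter (predC1 v) t).
Proof. by apply: eq_all => p /=; rewrite contains_del. Qed.

Lemma is_permutationP p : is_permutation p -> perm_eq p (iota 1 (size p)).
Proof. by case/andP. Qed.

Lemma order_iso_refl s : order_iso s s.
Proof. by apply/order_isoP. Qed.

(* A hit of length at most [k] in [t] that is not the whole of [t] uses the
   new maximum, hence misses one of the [minn k m] letters just below it. *)
Lemma avoids_ins Pi m p s :
  all is_permutation Pi -> perm_eq s (iota 1 m) -> avoids Pi s ->
  let t := ins p m.+1 s in
  avoids Pi t = (t \notin Pi) &&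
    all (fun v => avoids Pi (del v t))
        (iota (m - max_length Pi).+1 (m - (m - max_length Pi))).
Proof.
move=> /allP permPi ps avs t; set k := max_length Pi.
have pt : perm_eq t (iota 1 m.+1) by apply: ins_permutation.
have ft : filter (predC1 m.+1) t = s.
  by apply: filter_ins; apply: permutation_max_notin.
apply/idP/andP=> [avt|[tPi /allP avd]].
  split.
    apply/negP=> tPi; move/allP/(_ _ tPi): avt => /negP; apply.
    by apply/containsP; exists t; rewrite ?order_iso_refl.
  apply/allP=> v _; rewrite avoids_del; apply: avoids_subseq avt.
  exact: filter_subseq.
apply/allP=> pi piPi; apply/negP=> /containsP [u ut Hu].
have [szu _] := order_isoP _ _ Hu.
have piperm := is_permutationP (permPi _ piPi).
have uk : size u <= k.
  by rewrite szu /k /max_length (big_rem pi) //= leq_maxl.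
have uniqt := perm_iota_uniq pt.
have uniqu := subseq_uniq ut uniqt.
(* A hit of full length is [t] itself, and order-isomorphic permutations are equal, so the pattern
   would be [t]. *)
have [Eu|ltu] := eqVneq (size u) m.+1.
  have eut : u = t by apply/eqP; rewrite -(size_subseq_leqif ut) Eu (perm_iota_size pt).
  move: Hu; rewrite eut => /(order_iso_permutation pt) E.
  by move: tPi; rewrite E ?piPi // -Eu szu.
have szt := perm_iota_size pt.
have leu : size u <= m by rewrite -ltnS ltn_neqAle ltu -szt size_subseq.
have umiss v : v \notin u -> subseq u (filter (predC1 v) t).
  move=> vu; rewrite subseq_filter ut andbT; apply/allP=> x xu /=.
  by apply: contraNneq vu => <-.
have [Mu|Mu] := boolP (m.+1 \in u); last first.
  move: (allP avs _ piPi) => /negP; apply; apply/containsP; exists u => //.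
  by rewrite -ft; apply: umiss.
set I := iota _ _ in avd.
(* Pigeonhole: [m.+1 :: I] has [minn k m + 1] distinct letters, whereas [u] has at most [k] and at
   most [m]. *)
have : ~~ all (mem u) (m.+1 :: I).
  apply/negP=> /allP H.
  have uI : uniq (m.+1 :: I) by rewrite /= iota_uniq mem_iota /k; lia.
  have := uniq_leq_size uI H; rewrite /= size_iota.
  by move: uk leu; rewrite /k; lia.
rewrite /= Mu /= => /allPn [v vI vu].
move: (avd _ vI); rewrite avoids_del => /allP /(_ _ piPi) /negP; apply.
by apply/containsP; exists u => //; apply: umiss.
Qed.

(** * Breadth-first generation *)

Definition insertions (s : seq nat) : seq (seq nat) :=
  [seq ins p (size s).+1 s | p <- iota 0 (size s).+1].

Definition children Pi (s : seq nat) : seq (seq nat) := filter (avoids Pi) (insertions s).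

(** Level [i] consists of words of length [i + 1], in the order in which the queue receives them. *)
Fixpoint level Pi (i : nat) : seq (seq nat) :=
  if i is i'.+1 then flatten [seq children Pi s | s <- level Pi i']
  else filter (avoids Pi) [:: [:: 1]].

Lemma mem_avoiders Pi m t :
  (t \in avoiders Pi m) = perm_eq t (iota 1 m) && avoids Pi t.
Proof. by rewrite mem_filter mem_permutations andbC. Qed.

Lemma insertions_uniq m s : perm_eq s (iota 1 m) -> uniq (insertions s).
Proof.
move=> ps; rewrite map_inj_in_uniq ?iota_uniq // => p q.
rewrite !mem_iota !add0n !ltnS /= => hp hq E.
have ns : (size s).+1 \notin s by rewrite (perm_iota_size ps) permutation_max_notin.
by rewrite -(index_ins ns hp) -(index_ins ns hq) E.
Qed.

(** Erasing the maximum undoes its insertion, so every permutation of length [m + 1] has a unique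
    parent. *)
Lemma mem_insertions m (s t : seq nat) :
  perm_eq s (iota 1 m) ->
  (t \in insertions s) = perm_eq t (iota 1 m.+1) && (filter (predC1 m.+1) t == s).
Proof.
move=> ps; rewrite /insertions (perm_iota_size ps); apply/mapP/andP.
  case=> p _ ->; rewrite ins_permutation // filter_ins ?eqxx //.
  exact: permutation_max_notin.
case=> pt /eqP fs.
have Mt : m.+1 \in t by rewrite (perm_iota_mem _ pt) /=.
case/splitPr: Mt pt fs => t1 t2 pt fs.
have uniqt := perm_iota_uniq pt.
have szt := perm_iota_size pt.
have ft12 : [/\ filter (predC1 m.+1) t1 = t1 & filter (predC1 m.+1) t2 = t2].
  move: uniqt; rewrite uniq_catC /= mem_cat => /andP [].
  rewrite negb_or => /andP [n2 n1] _.
  by split; apply/all_filterP/allP=> x /= xt;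
     [apply: contraNneq n1 => <- | apply: contraNneq n2 => <-].
move: fs; rewrite filter_cat /= eqxx /= => fs.
case: ft12 fs => -> -> fs.
exists (size t1); first by rewrite (mem_iota 0 m.+1) -szt size_cat /= addnS ltnS leq_addr.
by rewrite /ins -fs take_size_cat // drop_size_cat.
Qed.

(** The map [g] recovers from an element the block it lies in, which makes the blocks disjoint. *)
Lemma flatten_map_uniq (A B : eqType) (f : A -> seq B) (g : B -> A) (r : seq A) :
  uniq r -> {in r, forall x, uniq (f x)} ->
  {in r, forall x y, y \in f x -> g y = x} -> uniq (flatten (map f r)).
Proof.
elim: r => //= x r IH /andP [xr ur] uf gf.
rewrite cat_uniq uf ?mem_head // IH //; last 2 first.
- by move=> y yr; apply: uf; rewrite inE yr orbT.
- by move=> y yr; apply: gf; rewrite inE yr orbT.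
rewrite andbT; apply/hasPn=> z /flatten_mapP [y yr zy].
apply/negP=> /= zx; move: xr; rewrite -(gf x _ z) ?mem_head //.
by rewrite (gf y _ z) ?yr // inE yr orbT.
Qed.

(** Avoidance is inherited by subsequences, so the parent of an avoider is an avoider of the
    previous level. Uniqueness of the parent rules out repetitions. *)
Lemma perm_level Pi i : perm_eq (level Pi i) (avoiders Pi i.+1).
Proof.
have ua m : uniq (avoiders Pi m) by rewrite filter_uniq // permutations_uniq.
elim: i => [|i IH].
  apply: uniq_perm; [exact: filter_uniq|exact: ua|move=> t].
  rewrite [RHS]mem_avoiders (_ : level Pi 0 = filter (avoids Pi) [:: [:: 1]]) //.
  rewrite mem_filter andbC inE; congr andb.
  apply/eqP/idP=> [->//|pt]; have := perm_iota_size pt; case: t pt => [|a [|]] //=.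
  by move/perm_mem/(_ a); rewrite !inE eqxx => /esym/eqP->.
have pl s : s \in level Pi i -> perm_eq s (iota 1 i.+1).
  by rewrite (perm_mem IH) mem_avoiders => /andP [].
apply: uniq_perm; rewrite ?ua //=.
  apply: (@flatten_map_uniq _ _ _ (filter (predC1 i.+2))).
  - by rewrite (perm_uniq IH).
  - by move=> s /pl ps; rewrite filter_uniq // (insertions_uniq ps).
  - move=> s /pl ps t; rewrite mem_filter (mem_insertions _ ps).
    by case/and3P=> _ _ /eqP.
move=> t; rewrite mem_avoiders; apply/flatten_mapP/andP.
  case=> s /pl ps; rewrite mem_filter (mem_insertions _ ps).
  by case/and3P.
(* No letter exceeds the maximum, so deleting it calls for no renormalisation and [del] is a plain
   filter. *)
case=> pt avt; have ps : perm_eq (filter (predC1 i.+2) t) (iota 1 i.+1).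
  have := @del_permutation i.+1 i.+2 t; rewrite /= leqnn => /(_ isT pt).
  rewrite /del /lower map_id_in // => x; rewrite mem_filter (perm_iota_mem _ pt).
  by move=> /andP [? ?]; lia.
exists (filter (predC1 i.+2) t).
  by rewrite (perm_mem IH) mem_avoiders ps (avoids_subseq (filter_subseq _ _) avt).
by rewrite mem_filter avt (mem_insertions _ ps) pt eqxx.
Qed.

(** This list has the order of the queue and agrees with [avoiders_le] up to permutation. *)
Definition bfs Pi m := flatten [seq level Pi i | i <- iota 0 m].

Lemma bfsS Pi m : bfs Pi m.+1 = bfs Pi m ++ level Pi m.
Proof. by rewrite /bfs -addn1 iotaD map_cat flatten_cat /= cats0. Qed.

Lemma perm_bfs Pi m : perm_eq (bfs Pi m) (avoiders_le Pi m).
Proof.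
rewrite /bfs /avoiders_le -[1]add1n iotaDl -map_comp.
elim: (iota 0 m) => //= i r IH; apply: perm_cat => //.
exact: perm_level.
Qed.

Lemma mem_avoiders_le Pi m t :
  (t \in avoiders_le Pi m) =
  [&& 0 < size t <= m, perm_eq t (iota 1 (size t)) & avoids Pi t].
Proof.
apply/flatten_mapP/and3P.
  case=> i; rewrite mem_iota mem_avoiders => hi /andP [pt ->].
  by rewrite (perm_iota_size pt); split=> //; lia.
case=> hs pt avt; exists (size t); first by rewrite mem_iota; lia.
by rewrite mem_avoiders pt.
Qed.

Lemma avoiders_le_uniq Pi m : uniq (avoiders_le Pi m).
Proof.
apply: (@flatten_map_uniq _ _ _ size); rewrite ?iota_uniq //.
- by move=> i _; rewrite filter_uniq // permutations_uniq.
- by move=> i _ t; rewrite mem_avoiders => /andP [/perm_iota_size].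
Qed.
(** * Encoded words *)

Definition blocks (j : nat) : pred (seq nat) := all (fun x => x < 2 ^ j).

Lemma encode_nil j : encode j [::] = 0.
Proof. by rewrite /encode big_ord0. Qed.

Lemma encode_cons j a s : encode j (a :: s) = a + encode j s * 2 ^ j.
Proof.
rewrite /encode /= big_ord_recl /= muln0 expn0 muln1; congr addn.
rewrite big_distrl /=; apply: eq_bigr => i _.
by rewrite /bump /= add1n mulnS expnD -mulnA [2 ^ j * _]mulnC.
Qed.

Lemma encode_cat j s t :
  encode j (s ++ t) = encode j s + encode j t * 2 ^ (j * size s).
Proof.
elim: s => [|a s IH] /=; first by rewrite encode_nil muln0 muln1.
by rewrite !encode_cons IH mulnDl addnA -mulnA -expnD mulnS [_ + j]addnC.
Qed.

Lemma encode_ltn j s : blocks j s -> encode j s < 2 ^ (j * size s).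
Proof.
elim: s => [|a s IH] /=; first by rewrite encode_nil expn_gt0.
case/andP=> aj /IH {}IH; rewrite encode_cons mulnS expnD.
have : (encode j s).+1 * 2 ^ j <= 2 ^ j * 2 ^ (j * size s).
  by rewrite mulnC leq_mul2l IH orbT.
by rewrite mulSn; lia.
Qed.

Lemma blocks_take j p s : blocks j s -> blocks j (take p s).
Proof. by move/allP=> H; apply/allP=> x /mem_take /H. Qed.

Lemma blocks_drop j p s : blocks j s -> blocks j (drop p s).
Proof. by move/allP=> H; apply/allP=> x /mem_drop /H. Qed.

Lemma encode_modn j p s :
  blocks j s -> p <= size s -> encode j s %% 2 ^ (j * p) = encode j (take p s).
Proof.
move=> bs ps; rewrite -{1}(cat_take_drop p s) encode_cat size_takel //.
rewrite addnC modnMDl modn_small //.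
by rewrite -{2}(size_takel ps) encode_ltn // blocks_take.
Qed.

Lemma encode_divn j p s :
  blocks j s -> p <= size s -> encode j s %/ 2 ^ (j * p) = encode j (drop p s).
Proof.
move=> bs ps; rewrite -{1}(cat_take_drop p s) encode_cat size_takel //.
rewrite addnC divnMDl ?expn_gt0 // divn_small ?addn0 //.
by rewrite -{2}(size_takel ps) encode_ltn // blocks_take.
Qed.

Definition pos_blocks (j : nat) : pred (seq nat) := all (fun x => 0 < x < 2 ^ j).

Lemma pos_blocksW j s : pos_blocks j s -> blocks j s.
Proof. by apply: sub_all => x /andP []. Qed.

(** A code does not record the length of its word, and trailing zero letters would be invisible.
    With positive letters, the lowest block and the quotient by [2 ^ j] determine the word
    recursively. *)
Lemma encode_inj j : {in pos_blocks j &, injective (encode j)}.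
Proof.
have cons_neq0 a s : pos_blocks j (a :: s) -> encode j (a :: s) != 0.
  by rewrite encode_cons => /andP [/andP [a0 _] _]; rewrite -lt0n addn_gt0 a0.
move=> s t; rewrite !unfold_in.
elim: s t => [|a s IH] [|b t] // => [_ pt|ps _|].
- by rewrite encode_nil => /eqP; rewrite eq_sym (negPf (cons_neq0 _ _ pt)).
- by rewrite encode_nil => /eqP; rewrite (negPf (cons_neq0 _ _ ps)).
case/andP=> /andP [_ aj] ps /andP [/andP [_ bj] pt]; rewrite !encode_cons => E.
have j0 : 0 < 2 ^ j by rewrite expn_gt0.
have /(congr1 (modn^~ (2 ^ j))) := E.
rewrite ![_ + _ * _]addnC !modnMDl !modn_small //.
have /(congr1 (divn^~ (2 ^ j))) := E.
rewrite ![_ + _ * _]addnC !divnMDl // !divn_small //.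
by rewrite !addn0 => /(IH _ ps pt) -> ->.
Qed.

Lemma permutation_blocks j m t : m < 2 ^ j -> perm_eq t (iota 1 m) -> pos_blocks j t.
Proof.
move=> mj pt; apply/allP=> x; rewrite (perm_iota_mem _ pt) => /andP [-> xm] /=.
exact: leq_ltn_trans xm mj.
Qed.

Lemma encode_neq0 j m t :
  0 < m < 2 ^ j -> perm_eq t (iota 1 m) -> 0 < encode j t.
Proof.
case/andP=> m0 mj pt; case: t pt (permutation_blocks mj pt) => [/perm_size|a t _].
  by rewrite size_iota /=; lia.
by case/andP=> /andP [a0 _] _; rewrite encode_cons addn_gt0 a0.
Qed.

(** The right-hand side mirrors the instructions of [insertion], as that of [encode_del] below
    mirrors [deletion_test]. *)
Lemma encode_ins j p a s :
  blocks j s -> p <= size s ->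
  encode j (ins p a s) =
  encode j s %% 2 ^ (j * p) +
  (encode j s %/ 2 ^ (j * p) * 2 ^ j + a) * 2 ^ (j * p).
Proof.
move=> bs ps; rewrite encode_modn // encode_divn // /ins encode_cat encode_cons.
by rewrite size_takel // [a + _]addnC.
Qed.

Lemma lower_blocks j v t : blocks j t -> blocks j (lower v t).
Proof.
move/allP=> bt; apply/allP=> _ /mapP [x /bt xj ->].
exact: leq_ltn_trans (leq_subr _ _) xj.
Qed.

Lemma del_take_drop v t :
  uniq t -> v \in t ->
  del v t = take (index v t) (lower v t) ++ drop (index v t).+1 (lower v t).
Proof.
move=> ut vt; rewrite -map_take -map_drop -map_cat /del; congr map.
by rewrite -rem_filter // remE.
Qed.

Lemma encode_del j v t :
  blocks j t -> uniq t -> v \in t ->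
  encode j (del v t) =
  encode j (lower v t) %/ 2 ^ (j * index v t) %/ 2 ^ j * 2 ^ (j * index v t) +
  encode j (lower v t) %% 2 ^ (j * index v t).
Proof.
move=> bt ut vt; have bl := lower_blocks v bt.
have it : index v t < size (lower v t) by rewrite size_map index_mem.
rewrite del_take_drop // encode_modn // ?(ltnW it) // -divnMA -expnD addnC.
rewrite -mulnSr encode_divn // encode_cat size_takel //.
exact: ltnW.
Qed.

(* The code of [lower v t] is thus updated in constant time as [v] decreases. *)
Lemma encode_lower_pred j v t :
  uniq t -> v.+1 \in t ->
  encode j (lower v.+1 t) = encode j (lower v t) + 2 ^ (j * index v.+1 t).
Proof.
elim: t => //= a t IH /andP [a_t ut]; rewrite inE !encode_cons.
(* Only the letter [v.+1] is treated differently by the two maps: it stays in one and drops to [v]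
   in the other. By uniqueness this happens in a single block. *)
have [E _|ne /= vt] := eqVneq a v.+1.
  rewrite E in a_t *; rewrite muln0 expn0 /lower.
  rewrite (_ : [seq x - (v.+1 < x) | x <- t] = [seq x - (v < x) | x <- t]); first by lia.
  apply/eq_in_map => x xt.
  have : x != v.+1 by apply: contraNneq a_t => <-.
  by lia.
by rewrite (IH ut vt) mulnS expnD mulnDl; lia.
Qed.
(** * Timed execution *)

Fixpoint written_regs (c : cmd) : seq nat :=
  match c with
  | Then c1 c2 | If _ _ _ c1 c2 => written_regs c1 ++ written_regs c2
  | Move r _ | Op r _ _ _ | Read r _ _ | Member r _ _ => [:: r]
  | While _ _ _ c1 => written_regs c1
  | Skip | Write _ _ _ | Insert _ _ => [::]
  end.

Fixpoint written_arrays (c : cmd) : seq nat :=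
  match c with
  | Then c1 c2 | If _ _ _ c1 c2 => written_arrays c1 ++ written_arrays c2
  | Write A _ _ => [:: A]
  | While _ _ _ c1 => written_arrays c1
  | _ => [::]
  end.

Fixpoint written_tables (c : cmd) : seq nat :=
  match c with
  | Then c1 c2 | If _ _ _ c1 c2 => written_tables c1 ++ written_tables c2
  | Insert H _ => [:: H]
  | While _ _ _ c1 => written_tables c1
  | _ => [::]
  end.

(** A frame condition read off the program text, so that invariants need not list the locations a
    fragment never writes. *)
Definition unchanged (c : cmd) (s s' : state) : Prop :=
  [/\ forall r, r \notin written_regs c -> regs s' r = regs s r,
      forall A, A \notin written_arrays c -> arrays s' A = arrays s A &
      forall H, H \notin written_tables c -> tables s' H = tables s H].

Lemma upd_other (T : Type) (f : nat -> T) i v i' :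
  i' \notin [:: i] -> upd f i v i' = f i'.
Proof. by rewrite inE /upd => /negPf ->. Qed.

Lemma exec_unchanged w c s t s' : exec w c s t s' -> unchanged c s s'.
Proof.
elim=> {c s t s'} [s|c1 c2 s t1 s1 t2 s2 _ IH1 _ IH2|r x s|r o x y s|r A x s|A x y s
  |H x s|r H x s|c x y c1 c2 s t s' _|c x y c1 s _|c x y c1 s t1 s1 t2 s2 _ _ IH1 _ IH2];
  rewrite /unchanged /=; try by split=> // ? ?; rewrite upd_other.
- case: IH1 IH2 => r1 a1 h1 [r2 a2 h2].
  by split=> i; rewrite mem_cat negb_or => /andP [? ?];
     rewrite ?r2 ?a2 ?h2 // ?r1 ?a1 ?h1.
- by case: ifP => _ [r1 a1 h1]; split=> i; rewrite mem_cat negb_or => /andP [? ?];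
     rewrite ?r1 ?a1 ?h1.
- case: IH1 IH2 => r1 a1 h1 [/= r2 a2 h2].
  by split=> i ?; rewrite ?r2 ?a2 ?h2 // ?r1 ?a1 ?h1.
Qed.

(** A total-correctness triple. The time is bounded rather than exact, so branches of different cost
    share one bound. *)
Definition runs (w : nat) (c : cmd) (s : state) (T : nat) (Q : state -> Prop) : Prop :=
  exists t s', [/\ exec w c s t s', t <= T & Q s'].

Lemma runs_seq w c1 c2 s T1 T2 (Q1 Q : state -> Prop) :
  runs w c1 s T1 Q1 ->
  (forall s1, unchanged c1 s s1 -> Q1 s1 -> runs w c2 s1 T2 Q) ->
  runs w (Then c1 c2) s (T1 + T2) Q.
Proof.
move=> [t1 [s1 [e1 le1 q1]]] /(_ s1 (exec_unchanged e1) q1) [t2 [s2 [e2 le2 q2]]].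
by exists (t1 + t2), s2; split=> //; [apply: exec_then e1 e2 | apply: leq_add].
Qed.

Lemma runs_weaken w c s T T' (Q Q' : state -> Prop) :
  runs w c s T Q -> T <= T' -> (forall s', unchanged c s s' -> Q s' -> Q' s') ->
  runs w c s T' Q'.
Proof.
move=> [t [s' [e le q]]] leT QQ'; exists t, s'; split=> //.
  exact: leq_trans le leT.
exact: QQ' (exec_unchanged e) q.
Qed.

Lemma runs_if w c x y c1 c2 s T Q :
  runs w (if test w s c x y then c1 else c2) s T Q -> runs w (If c x y c1 c2) s T.+1 Q.
Proof.
by move=> [t [s' [e le q]]]; exists t.+1, s'; split=> //; apply: exec_if.
Qed.

(** The number [N] of rounds is known beforehand and the invariant is indexed by the round. Each
    round pays one test besides its body, and the failing test pays one more. *)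
Lemma runs_while w c x y c1 s N (T : nat -> nat) (I : nat -> state -> Prop) :
  I 0 s ->
  (forall i s1, i < N -> unchanged c1 s s1 -> I i s1 ->
     test w s1 c x y /\ runs w c1 s1 (T i) (I i.+1)) ->
  (forall s1, unchanged c1 s s1 -> I N s1 -> ~~ test w s1 c x y) ->
  runs w (While c x y c1) s (\sum_(i < N) (T i).+1).+1 (I N).
Proof.
have : unchanged c1 s s by [].
(* The current state [s1] varies in the induction, while the frame condition stays relative to the
   entry state [s]. *)
move: {2 3 6}s => s1; elim: N I T s1 => [|N IH] I T s1 us I0 step stop.
  exists 1, s1; rewrite big_ord0; split=> //.
  by apply: exec_while_false; apply: stop us I0.
have [tst [t1 [s2 [e1 le1 q1]]]] := step 0 s1 isT us I0.
have us2 : unchanged c1 s s2.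
  case: us (exec_unchanged e1) => r1 a1 h1 [r2 a2 h2].
  by split=> i ?; rewrite ?r2 ?a2 ?h2 ?r1 ?a1 ?h1.
have [t2 [s3 [e2 le2 q2]]] :=
  IH (fun i => I i.+1) (fun i => T i.+1) s2 us2 q1 (fun i s' => step i.+1 s') stop.
exists (t1 + t2).+1, s3; split=> //; first exact: exec_while_true e1 e2.
rewrite big_ord_recl (eq_bigr (fun i : 'I_N => (T i.+1).+1)) //.
by move: le1 le2 => /=; lia.
Qed.

Fixpoint loop_free (c : cmd) : bool :=
  match c with
  | Then c1 c2 | If _ _ _ c1 c2 => loop_free c1 && loop_free c2
  | While _ _ _ _ => false
  | _ => true
  end.

(** Straight-line code is verified by computation. The value on a loop is a dummy, [eval] being used
    for [loop_free] programs. *)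
Fixpoint eval (w : nat) (c : cmd) (s : state) : state :=
  match c with
  | Skip | While _ _ _ _ => s
  | Then c1 c2 => eval w c2 (eval w c1 s)
  | Move r x => set_reg s r (oval w s x)
  | Op r o x y => set_reg s r (binop_val w o (oval w s x) (oval w s y))
  | Read r A x => set_reg s r (arrays s A (oval w s x))
  | Write A x y => set_cell s A (oval w s x) (oval w s y)
  | Insert H x => add_key s H (oval w s x)
  | Member r H x => set_reg s r (tables s H (oval w s x))
  | If c x y c1 c2 => if test w s c x y then eval w c1 s else eval w c2 s
  end.

Fixpoint cost (c : cmd) : nat :=
  match c with
  | Skip => 0
  | Then c1 c2 => cost c1 + cost c2
  | If _ _ _ c1 c2 => (maxn (cost c1) (cost c2)).+1
  | _ => 1
  end.

Lemma runs_eval w c s (Q : state -> Prop) :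
  loop_free c -> Q (eval w c s) -> runs w c s (cost c) Q.
Proof.
elim: c s Q => [|c1 IH1 c2 IH2|r x|r o x y|A r x|A x y|H x|r H x|c x y c1 IH1 c2 IH2|//]
  s Q /=; try by move=> _ ?; eexists _, _; split; [constructor| |].
- case/andP=> lf1 lf2 HQ; apply: (runs_seq (Q1 := eq (eval w c1 s))); first exact: IH1.
  by move=> _ _ <-; apply: IH2.
- case/andP=> lf1 lf2 HQ; apply: runs_if; case: ifP HQ => _ HQ.
    by apply: runs_weaken (IH1 _ _ lf1 HQ) (leq_maxl _ _) _.
  by apply: runs_weaken (IH2 _ _ lf2 HQ) (leq_maxr _ _) _.
Qed.

Lemma binop_addE w a b : a + b < 2 ^ w -> binop_val w Add a b = a + b.
Proof. exact: modn_small. Qed.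

Lemma binop_mulE w a b : a * b < 2 ^ w -> binop_val w Mul a b = a * b.
Proof. exact: modn_small. Qed.

Lemma binop_shlE w a b : a * 2 ^ b < 2 ^ w -> binop_val w Shl a b = a * 2 ^ b.
Proof. exact: modn_small. Qed.

Lemma binop_subE w a b : b <= a -> a < 2 ^ w -> binop_val w Defs.Sub a b = a - b.
Proof.
move=> ba aw; rewrite /= addnBA ?(leq_trans ba (ltnW aw)) // -addnBAC // modnDr.
by rewrite modn_small //; apply: leq_ltn_trans (leq_subr _ _) aw.
Qed.

(** * The program *)

Notation "c1 ;; c2" := (Then c1 c2) (at level 60, right associativity).

(* Register 0 holds [n], 1 holds [k], 2 holds [j], 3 the length of the queue
   (array 0), 4 its read position, 5 the length [m] of the current word [s],
   whose code is in 7; array 1 holds the positions of the letters of [s], and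
   table 1 the codes of the queued words.  Register 8 is the insertion position
   [p], 11 is [m.+1], 12 the code of [t := ins p m.+1 s], 13 tells whether [t]
   is rejected, 14 is the letter [v] to be deleted and 15 the code of
   [lower v t]. *)

Definition deletion_position : cmd :=
  Read 17 1 (Reg 14) ;;
  If CLt (Reg 17) (Reg 8) Skip (Op 17 Add (Reg 17) (Lit 1)) ;;
  Op 17 Mul (Reg 17) (Reg 2).

Definition deletion_test : cmd :=
  Op 18 Shr (Reg 15) (Reg 17) ;;
  Op 18 Shr (Reg 18) (Reg 2) ;;
  Op 18 Shl (Reg 18) (Reg 17) ;;
  Op 19 ModPow2 (Reg 15) (Reg 17) ;;
  Op 18 Add (Reg 18) (Reg 19) ;;
  Member 19 1 (Reg 18) ;;
  If CEq (Reg 19) (Lit 0) (Move 13 (Lit 1)) Skip.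

Definition next_letter : cmd :=
  Op 17 Shl (Lit 1) (Reg 17) ;;
  Op 15 Defs.Sub (Reg 15) (Reg 17) ;;
  Op 14 Defs.Sub (Reg 14) (Lit 1).

(** Register 16 gets the truncated difference of [m] and [k], by a branch because machine
    subtraction wraps around. As [lower m.+1 t] is [t], one subtraction from the code of [t] gives
    that of [lower m t]. *)
Definition check_init : cmd :=
  If CLt (Reg 5) (Reg 1) (Move 16 (Lit 0)) (Op 16 Defs.Sub (Reg 5) (Reg 1)) ;;
  Op 17 Shl (Lit 1) (Reg 9) ;;
  Op 15 Defs.Sub (Reg 12) (Reg 17) ;;
  Move 14 (Reg 5).

Definition check : cmd :=
  check_init ;;
  While CLt (Reg 16) (Reg 14) (deletion_position ;; deletion_test ;; next_letter).

Definition insertion : cmd :=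
  Op 9 Mul (Reg 8) (Reg 2) ;;
  Op 10 Shr (Reg 7) (Reg 9) ;;
  Op 10 Shl (Reg 10) (Reg 2) ;;
  Op 10 Add (Reg 10) (Reg 11) ;;
  Op 10 Shl (Reg 10) (Reg 9) ;;
  Op 12 ModPow2 (Reg 7) (Reg 9) ;;
  Op 12 Add (Reg 12) (Reg 10) ;;
  Member 13 0 (Reg 12).

Definition enqueue : cmd :=
  If CEq (Reg 13) (Lit 0)
    (Write 0 (Reg 3) (Reg 12) ;; Insert 1 (Reg 12) ;; Op 3 Add (Reg 3) (Lit 1))
    Skip ;;
  Op 8 Add (Reg 8) (Lit 1).

Definition expand : cmd :=
  (Op 11 Add (Reg 5) (Lit 1) ;; Move 8 (Lit 0)) ;;
  While CLt (Reg 8) (Reg 11) (insertion ;; check ;; enqueue).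

(** The letters are peeled off from the lowest block. A permutation of length [m] overwrites all
    cells [1 .. m], so no entry of an earlier word survives there. *)
Definition invert : cmd :=
  (Move 8 (Lit 0) ;; Move 9 (Reg 7)) ;;
  While CLt (Reg 8) (Reg 5)
    (Op 10 ModPow2 (Reg 9) (Reg 2) ;;
     Write 1 (Reg 10) (Reg 8) ;;
     Op 9 Shr (Reg 9) (Reg 2) ;;
     Op 8 Add (Reg 8) (Lit 1)).

(** Register 6 freezes the end of the current level while the queue grows with the next one. *)
Definition process_level : cmd :=
  Move 6 (Reg 3) ;;
  While CLt (Reg 4) (Reg 6)
    (Read 7 0 (Reg 4) ;; invert ;; expand ;; Op 4 Add (Reg 4) (Lit 1)) ;;
  Op 5 Add (Reg 5) (Lit 1).

Definition search_init : cmd :=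
  Move 3 (Lit 1) ;; Write 0 (Lit 0) (Lit 1) ;; Insert 1 (Lit 1) ;; Move 5 (Lit 1).

Definition search : cmd :=
  search_init ;; While CLt (Reg 5) (Reg 0) process_level ;; Move 0 (Reg 3).

(** The literal 1 is the code of the word [[:: 1]]. If that word is a pattern there are no avoiders;
    otherwise it starts the search. *)
Definition generate : cmd :=
  Member 3 0 (Lit 1) ;; If CEq (Reg 3) (Lit 1) (Move 0 (Lit 0)) search.

Arguments binop_val : simpl never.

(** This justifies the conditional increment in [deletion_position]: positions are tabulated for
    [s], and those from [p] on move one place to the right in [t]. *)
Lemma index_ins_other p a (s : seq nat) v :
  v != a -> v \in s -> index v (ins p a s) = index v s + (p <= index v s).
Proof.
move=> va vs; rewrite /ins index_cat /= eq_sym (negPf va).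
have := index_cat v (take p s) (drop p s); rewrite cat_take_drop => ->.
have [ps|ps] := leqP (size s) p.
  rewrite take_oversize // drop_oversize // vs.
  have : index v s < size s by rewrite index_mem.
  lia.
case: ifPn => vt.
  have : index v (take p s) < size (take p s) by rewrite index_mem.
  by rewrite size_takel ?(ltnW ps) //; lia.
by rewrite size_takel ?(ltnW ps) // leq_addr; lia.
Qed.

(** * Correctness and running time of the program *)

Section Correctness.

Variables (Pi : seq (seq nat)) (n j w : nat).
Let k := max_length Pi.
Hypothesis permPi : all is_permutation Pi.
Hypothesis k_gt0 : 0 < k.
Hypothesis n_gt0 : 0 < n.
Hypothesis fits : maxn n k < 2 ^ j /\ maxn n k * j <= w.

Lemma n_lt : n < 2 ^ j. Proof. by apply: leq_ltn_trans fits.1; apply: leq_maxl. Qed.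
Lemma k_lt : k < 2 ^ j. Proof. by apply: leq_ltn_trans fits.1; apply: leq_maxr. Qed.
Lemma nj_le : n * j <= w.
Proof. by apply: leq_trans fits.2; rewrite leq_mul2r leq_maxl orbT. Qed.
Lemma j_le : j <= w. Proof. by apply: leq_trans nj_le; rewrite leq_pmull. Qed.

Lemma word_j x : x < 2 ^ j -> x < 2 ^ w.
Proof. by move=> xj; apply: leq_trans xj _; rewrite leq_exp2l // j_le. Qed.

Lemma word_le_w x : x <= w -> x < 2 ^ w.
Proof. by move=> xw; apply: leq_ltn_trans xw _; apply: ltn_expl. Qed.

Lemma word_1 : 1 < 2 ^ w. Proof. by apply: word_j; apply: leq_ltn_trans n_gt0 n_lt. Qed.

Lemma word_encode s : blocks j s -> size s <= n -> encode j s < 2 ^ w.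
Proof.
move=> bs sn; apply: leq_trans (encode_ltn bs) _; rewrite leq_exp2l //.
by apply: leq_trans nj_le; rewrite mulnC leq_mul2r sn orbT.
Qed.

Lemma lit1 : 1 %% 2 ^ w = 1. Proof. exact: modn_small word_1. Qed.

Definition listed (qs : seq (seq nat)) (s : state) : Prop :=
  tables s 1 =1 mem (map (encode j) qs).

Definition patterns_listed (s : state) : Prop :=
  tables s 0 =1 mem (map (encode j) Pi).

Section Word.

Variables (m : nat) (sigma : seq nat).
Hypothesis m_lt : m < n.
Hypothesis perm_sigma : perm_eq sigma (iota 1 m).

Lemma size_sigma : size sigma = m. Proof. exact: perm_iota_size perm_sigma. Qed.
Lemma uniq_sigma : uniq sigma. Proof. exact: perm_iota_uniq perm_sigma. Qed.
Lemma blocks_sigma : blocks j sigma.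
Proof.
apply/pos_blocksW/permutation_blocks/perm_sigma.
exact: ltn_trans m_lt n_lt.
Qed.

Definition word_state (s : state) : Prop :=
  [/\ regs s 1 = k, regs s 2 = j, regs s 5 = m &
      forall v, v \in sigma -> arrays s 1 v = index v sigma].

(** * Testing one insertion of the new maximum *)

Section Insertion.

Variables (p : nat) (qs : seq (seq nat)).
Hypothesis p_le : p <= m.
Hypothesis qs_blocks : all (pos_blocks j) qs.
(** During a level the queue also receives words of length [m.+1], so membership is prescribed for
    length [m], the length of every word looked up. *)
Hypothesis qs_complete : forall u, perm_eq u (iota 1 m) -> (u \in qs) = avoids Pi u.
Let t := ins p m.+1 sigma.

Lemma perm_t : perm_eq t (iota 1 m.+1). Proof. exact: ins_permutation. Qed.
Lemma uniq_t : uniq t. Proof. exact: perm_iota_uniq perm_t. Qed.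
Lemma size_t : size t = m.+1. Proof. exact: perm_iota_size perm_t. Qed.
Lemma blocks_t : blocks j t.
Proof.
apply/pos_blocksW/permutation_blocks/perm_t.
exact: leq_ltn_trans m_lt n_lt.
Qed.

Definition deletion_state (v : nat) (b : bool) (s : state) : Prop :=
  [/\ regs s 13 = b, regs s 14 = v & regs s 15 = encode j (lower v t)].

(** Injectivity of the code turns the table lookup into membership in [qs], which for words of
    length [m] decides avoidance. *)
Lemma listed_del v s : 0 < v <= m.+1 -> listed qs s ->
  tables s 1 (encode j (del v t)) = avoids Pi (del v t).
Proof.
move=> vm ->; have pd := del_permutation vm perm_t.
rewrite -qs_complete //.
have bd : del v t \in pos_blocks j.
  by apply: permutation_blocks pd; apply: ltn_trans m_lt n_lt.
apply/mapP/idP => [[u uqs E]|dqs]; last by exists (del v t).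
by rewrite (encode_inj bd (allP qs_blocks _ uqs) E).
Qed.

Lemma index_t_le v : 0 < v <= m.+1 -> index v t <= m.
Proof. by move=> vm; rewrite -ltnS -size_t index_mem (perm_iota_mem _ perm_t). Qed.

Lemma word_index v : 0 < v <= m.+1 -> (index v t).+1 * j <= w.
Proof.
move=> vm; apply: leq_trans nj_le; rewrite leq_mul2r; apply/orP; right.
by apply: leq_ltn_trans m_lt; apply: index_t_le.
Qed.

Lemma runs_deletion_position v s :
  0 < v <= m -> word_state s -> regs s 8 = p -> regs s 14 = v ->
  runs w deletion_position s (cost deletion_position)
    (fun s' => regs s' 17 = j * index v t).
Proof.
move=> vm [r1 r2 r5 inv] r8 r14.
have vs : v \in sigma by rewrite (perm_iota_mem _ perm_sigma).
have vm1 : 0 < v <= m.+1 by lia.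
have Et : index v t = index v sigma + (p <= index v sigma).
  by apply: index_ins_other => //; lia.
have wi := word_index vm1.
apply: runs_eval => //=; rewrite /test /= /upd /= r14 r8 inv // lit1.
case: ltnP Et => pi Et; rewrite /= /upd /= r2.
  rewrite binop_mulE; first by rewrite Et addn0 mulnC.
  by apply: word_le_w; move: wi; rewrite Et; lia.
rewrite binop_addE; last by apply: word_j; have := index_t_le vm1; lia.
rewrite binop_mulE; first by rewrite Et mulnC.
by apply: word_le_w; move: wi; rewrite Et; lia.
Qed.

Lemma runs_deletion_test v b s :
  0 < v <= m -> word_state s -> listed qs s -> deletion_state v b s ->
  regs s 17 = j * index v t ->
  runs w deletion_test s (cost deletion_test)
    (fun s' => regs s' 13 = (b || ~~ avoids Pi (del v t)) :> nat).
Proof.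
move=> vm [r1 r2 r5 inv] ls [r13 r14 r15] r17.
have vm1 : 0 < v <= m.+1 by lia.
have vt : v \in t by rewrite (perm_iota_mem _ perm_t).
have wd : encode j (del v t) < 2 ^ w.
  have pd := del_permutation vm1 perm_t.
  apply: word_encode; last by rewrite (perm_iota_size pd) ltnW.
  by apply/pos_blocksW/permutation_blocks/pd; apply: ltn_trans m_lt n_lt.
have Ed := encode_del blocks_t uniq_t vt.
apply: runs_eval => //=; rewrite /test /= /upd /= r15 r17 r2 lit1 mod0n.
rewrite -[binop_val _ Shr _ (j * _)]/(_ %/ _) -[binop_val _ Shr _ j]/(_ %/ _).
rewrite -[binop_val _ ModPow2 _ _]/(_ %% _).
rewrite binop_shlE; last by move: wd; rewrite Ed; lia.
rewrite binop_addE -Ed // (listed_del vm1) //.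
by case: (avoids _ _); rewrite /= /upd /= ?r13 ?orbF ?orbT.
Qed.

Lemma encode_lower_index v :
  0 < v <= m.+1 -> encode j (lower v t) = encode j (lower v.-1 t) + 2 ^ (j * index v t).
Proof.
case: v => // v vm; rewrite encode_lower_pred ?uniq_t //.
by rewrite (perm_iota_mem _ perm_t).
Qed.

Lemma word_lower v : encode j (lower v t) < 2 ^ w.
Proof. by apply: word_encode; rewrite ?lower_blocks ?blocks_t // size_map size_t. Qed.

Lemma runs_next_letter v b s :
  0 < v <= m -> deletion_state v b s -> regs s 17 = j * index v t ->
  runs w next_letter s (cost next_letter) (deletion_state v.-1 b).
Proof.
move=> vm [r13 r14 r15] r17.
have vm1 : 0 < v <= m.+1 by lia.
(* This identity shows that the power of two is a word and that subtracting it does not wrap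
   around. *)
have El := encode_lower_index vm1.
have wl := word_lower v.
apply: runs_eval => //; rewrite /deletion_state /= /upd /= lit1 r13 r14 r15 r17.
rewrite binop_shlE mul1n; last by lia.
rewrite !binop_subE; try lia.
  by split=> //; lia.
by apply: word_j; lia.
Qed.

Lemma runs_check (b : bool) s :
  word_state s -> listed qs s ->
  [/\ regs s 8 = p, regs s 9 = j * p, regs s 12 = encode j t & regs s 13 = b] ->
  runs w check s (30 * k + 10)
    (fun s' => regs s' 13 = (b || ~~ all (fun v => avoids Pi (del v t))
                                      (iota (m - k).+1 (m - (m - k)))) :> nat).
Proof.
move=> ws ls [r8 r9 r12 r13]; case: (ws) => [r1 r2 r5 inv].
have Et : index m.+1 t = p.
  by apply: index_ins; rewrite ?size_sigma // permutation_max_notin.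
have lt : lower m.+1 t = t.
  rewrite /lower map_id_in // => x; rewrite (perm_iota_mem _ perm_t); lia.
have El : encode j t = encode j (lower m t) + 2 ^ (j * p).
  by rewrite -{1}lt encode_lower_index ?Et //=; lia.
have wt : encode j t < 2 ^ w by apply: word_encode; rewrite ?size_t ?blocks_t.
set N := m - (m - k).
have init : runs w check_init s (cost check_init)
    (fun s' => regs s' 16 = m - k /\ deletion_state m b s').
  apply: runs_eval => //; rewrite /deletion_state /= /test /= /upd /= r5 r1.
  case: ltnP => mk; rewrite /= /upd /= lit1 ?r5 ?r9 ?r12 ?r13 binop_shlE mul1n; try lia.
    by rewrite binop_subE ?mod0n; try lia; do! split; lia.
  rewrite !binop_subE; try lia.
    by do! split; lia.
  by apply: word_j; lia.
(* After [i] rounds the letters from [m] down to [m - i + 1] have been tested; there are [minn k m]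
   rounds of constant cost. *)
pose I i s' := deletion_state (m - i)
  (b || ~~ all (fun v => avoids Pi (del v t)) (iota (m - i).+1 i)) s'.
pose T (_ : nat) := cost (deletion_position ;; deletion_test ;; next_letter).
have R : runs w check s (cost check_init + (\sum_(i < N) (T i).+1).+1) (I N).
  apply: runs_seq init _ => s1 [u1 a1 h1] [r16 ds1].
  apply: (@runs_while w _ _ _ _ s1 N T I)
    => [|i s2 iN [u2 a2 h2] ds|s2 [u2 a2 h2] [_ r14 _]].
  - by rewrite /I subn0 orbF.
  - have ws2 : word_state s2 by split=> *; rewrite ?u2 ?u1 ?a2 ?a1 // inv.
    have ls2 : listed qs s2 by move=> x; rewrite h2 ?h1 // ls.
    have vm : 0 < m - i <= m by lia.
    case: (ds) => r13' r14 r15.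
    split; first by rewrite /test /= r14 u2 // r16; lia.
    apply: runs_seq (runs_deletion_position vm ws2 _ r14) _; first by rewrite u2 ?u1.
    move=> s3 [u3 a3 h3] r17.
    have ds3 : I i s3 by split; rewrite u3.
    have ws3 : word_state s3 by split=> *; rewrite ?u3 ?a3 //; case: ws2 => // ? ? ? ->.
    have ls3 : listed qs s3 by move=> x; rewrite h3 // ls2.
    apply: runs_seq (runs_deletion_test vm ws3 ls3 ds3 r17) _ => s4 [u4 a4 h4] r13''.
    have r14' : regs s4 14 = m - i by rewrite u4 // u3.
    have r15' : regs s4 15 = encode j (lower (m - i) t) by rewrite u4 // u3.
    have ds4 := And3 r13'' r14' r15'.
    apply: runs_weaken (runs_next_letter vm ds4 _) _ _ => //; first by rewrite u4.
    move=> s5 _; rewrite /I (_ : (m - i.+1).+1 = m - i); last by lia.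
    rewrite -subnS /= [all _ _ && _]andbC negb_and orbA //.
  by rewrite /test /= r14 u2 // r16 /N; lia.
apply: runs_weaken R _ _ => [|s' _ [-> _ _]].
  by rewrite /T big_const_ord iter_addn_0 /= /N; lia.
by rewrite /N subKn // leq_subr.
Qed.

Lemma listed_pattern s : patterns_listed s -> tables s 0 (encode j t) = (t \in Pi).
Proof.
move=> ->.
have bt : t \in pos_blocks j.
  by apply: permutation_blocks perm_t; apply: leq_ltn_trans m_lt n_lt.
apply/mapP/idP => [[u uPi E]|tPi]; last by exists t.
rewrite (encode_inj bt _ E) //.
apply: permutation_blocks (is_permutationP (allP permPi _ uPi)).
by apply: leq_ltn_trans k_lt; rewrite /k /max_length (big_rem u) //= leq_maxl.
Qed.

Lemma runs_insertion s :
  regs s 2 = j -> regs s 7 = encode j sigma -> regs s 8 = p -> regs s 11 = m.+1 ->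
  patterns_listed s ->
  runs w insertion s (cost insertion)
    (fun s' => [/\ regs s' 9 = j * p, regs s' 12 = encode j t & regs s' 13 = (t \in Pi)]).
Proof.
move=> r2 r7 r8 r11 ps.
have wt : encode j t < 2 ^ w by apply: word_encode; rewrite ?size_t ?blocks_t.
have Et := @encode_ins j p m.+1 sigma blocks_sigma; rewrite size_sigma in Et.
have {}Et := Et p_le; rewrite -/t in Et.
apply: runs_eval => //=; rewrite /upd /= r2 r7 r8 r11.
rewrite binop_mulE [p * j]mulnC; last first.
  apply: word_le_w; apply: leq_trans nj_le; rewrite mulnC leq_mul2r.
  by rewrite (leq_trans p_le (ltnW m_lt)) orbT.
rewrite -[binop_val _ Shr _ _]/(_ %/ _) -[binop_val _ ModPow2 _ _]/(_ %% _).
have pw : 0 < 2 ^ (j * p) by rewrite expn_gt0.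
(* The intermediate values of the assembly are bounded by the final code, so none of them
   overflows. *)
have le1 : encode j sigma %/ 2 ^ (j * p) * 2 ^ j + m.+1 <= encode j t.
  by rewrite Et; apply: leq_trans (leq_addl _ _); apply: leq_pmulr.
rewrite (@binop_shlE w (_ %/ _) j); last first.
  by apply: leq_ltn_trans wt; apply: leq_trans le1; apply: leq_addr.
rewrite (@binop_addE w _ m.+1); last exact: leq_ltn_trans wt.
rewrite binop_shlE; last by apply: leq_ltn_trans wt; rewrite Et; apply: leq_addl.
rewrite binop_addE; last by rewrite -Et.
by rewrite -Et listed_pattern.
Qed.

End Insertion.

(** * Expanding one word of the queue *)

Definition queue (qs : seq (seq nat)) (s : state) : Prop :=
  [/\ regs s 3 = size qs,
      forall i, i < size qs -> arrays s 0 i = encode j (nth [::] qs i) &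
      listed qs s].

Lemma runs_enqueue qs t (b : bool) p s :
  queue qs s -> regs s 8 = p -> p < n -> regs s 12 = encode j t -> regs s 13 = b ->
  (~~ b -> (size qs).+1 < 2 ^ w) ->
  runs w enqueue s (cost enqueue)
    (fun s' => regs s' 8 = p.+1 /\ queue (if b then qs else rcons qs t) s').
Proof.
move=> [r3 a0 ls] r8 pn r12 r13 sz; apply: runs_eval => //=.
have wp : p.+1 < 2 ^ w by apply: word_j; apply: leq_ltn_trans n_lt.
rewrite /test /= /upd /= r13 mod0n; case: b {r13} sz => /= sz.
  by rewrite r8 lit1 binop_addE addn1.
rewrite /queue /listed /= /upd /= r8 r3 r12 lit1 !binop_addE ?addn1 ?sz //.
rewrite size_rcons; do! split=> //.
  move=> i; rewrite ltnS nth_rcons; case: ltngtP => // ip _; exact: a0.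
move=> x; rewrite map_rcons /= mem_rcons inE; case: eqP => //= _; exact: ls.
Qed.

Lemma runs_expand qs s :
  avoids Pi sigma -> all (pos_blocks j) qs ->
  (forall u, perm_eq u (iota 1 m) -> (u \in qs) = avoids Pi u) ->
  size (qs ++ children Pi sigma) < 2 ^ w ->
  word_state s -> regs s 7 = encode j sigma -> patterns_listed s -> queue qs s ->
  runs w expand s (n * (30 * k + 24) + 3) (queue (qs ++ children Pi sigma)).
Proof.
move=> avs bqs cqs szw ws r7 ps qu; case: (ws) => r1 r2 r5 inv.
pose Q i := qs ++ [seq t <- take i (insertions sigma) | avoids Pi t].
pose I i s' := regs s' 8 = i /\ queue (Q i) s'.
pose c0 := Op 11 Add (Reg 5) (Lit 1) ;; Move 8 (Lit 0).
have init : runs w c0 s (cost c0) (fun s' => regs s' 11 = m.+1 /\ I 0 s').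
  apply: runs_eval => //; rewrite /I /queue /listed /Q take0 cats0 /= /upd /=.
  rewrite r5 lit1 mod0n binop_addE ?addn1 //; apply: word_j.
  exact: leq_ltn_trans n_lt.
(* The costs are 8 for [insertion] and 5 for [enqueue]; with the loop test this makes [30 * k + 24]
   per position. *)
pose T (_ : nat) := cost insertion + (30 * k + 10 + cost enqueue).
have R : runs w expand s (cost c0 + (\sum_(i < m.+1) (T i).+1).+1) (I m.+1).
  apply: runs_seq init _ => s1 [u1 a1 h1] [r11 I0].
  apply: (@runs_while w _ _ _ _ s1 m.+1 T I)
    => // [i s2 im [u2 a2 h2] [r8 q2]|s2 [u2 _ _] [r8 _]];
    last by rewrite /test /= r8 u2 // r11 ltnn.
  split; first by rewrite /test /= r8 u2 // r11.
  have ws2 : word_state s2 by split=> *; rewrite ?u2 ?u1 ?a2 ?a1 // inv.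
  have ps2 : patterns_listed s2 by move=> x; rewrite h2 // h1 // ps.
  have im' : i <= m by [].
  apply: runs_seq (runs_insertion im' _ _ r8 _ ps2) _; rewrite ?u2 // ?u1 //.
  move=> s3 [u3 a3 h3] [r9 r12 r13].
  have ws3 : word_state s3 by case: ws2 => *; split=> *; rewrite ?u3 ?a3 //; eauto.
  have ls3 : listed (Q i) s3 by case: q2 => _ _ ls x; rewrite h3 // ls.
  have tkI t : t \in take i (insertions sigma) -> perm_eq t (iota 1 m.+1).
    by move/mem_take; rewrite (mem_insertions _ perm_sigma) => /andP [].
  have bQ : all (pos_blocks j) (Q i).
    rewrite all_cat bqs /=; apply/allP=> t; rewrite mem_filter => /andP [_ /tkI pt].
    by apply: permutation_blocks pt; apply: leq_ltn_trans m_lt n_lt.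
  (* Every word added so far is an avoider, so the answers for words of length [m] are
     unaffected. *)
  have cQ u : perm_eq u (iota 1 m) -> (u \in Q i) = avoids Pi u.
    move=> pu; rewrite mem_cat cqs // mem_filter; by case: (avoids Pi u).
  apply: runs_seq (runs_check im' bQ cQ ws3 ls3 _) _.
    by split; [rewrite u3 | exact: r9 | exact: r12 | exact: r13].
  move=> s4 [u4 a4 h4] r13'; set t := ins i m.+1 sigma in r12 r13'.
  have {}r13' : regs s4 13 = ~~ avoids Pi t.
    by rewrite r13' /t avoids_ins // negb_and negbK.
  have QS : Q i.+1 = if ~~ avoids Pi t then Q i else rcons (Q i) t.
    rewrite /Q (take_nth [::]) ?filter_rcons; last first.
      by rewrite size_map size_iota size_sigma.
    rewrite /insertions (nth_map 0) ?size_iota ?size_sigma // nth_iota // add0n -/t.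
    by case: (avoids Pi t); rewrite // rcons_cat.
  rewrite /I QS.
  have q4 : queue (Q i) s4.
    case: q2 => r3 a0 ls; split; first by rewrite u4 // u3.
      by move=> a aQ; rewrite a4 // a3 // a0.
    by move=> x; rewrite h4 // h3 // ls.
  have r8' : regs s4 8 = i by rewrite u4 // u3.
  have r12' : regs s4 12 = encode j t by rewrite u4.
  apply: runs_enqueue q4 r8' (leq_ltn_trans im' m_lt) r12' r13' _.
  rewrite negbK => avt; apply: leq_ltn_trans szw.
  have -> : (size (Q i)).+1 = size (Q i.+1) by rewrite QS avt size_rcons.
  rewrite /Q !size_cat leq_add2l.
  rewrite /children -{2}(cat_take_drop i.+1 (insertions sigma)).
  by rewrite filter_cat size_cat leq_addr.
apply: runs_weaken R _ _ => [|s' _ [_]].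
  rewrite /T big_const_ord iter_addn_0 /=.
  have : m.+1 * (30 * k + 24) <= n * (30 * k + 24) by rewrite leq_mul2r m_lt orbT.
  by lia.
by rewrite /Q take_oversize // size_map size_iota size_sigma.
Qed.

Lemma runs_invert s :
  regs s 2 = j -> regs s 5 = m -> regs s 7 = encode j sigma ->
  runs w invert s (5 * n + 3)
    (fun s' => forall v, v \in sigma -> arrays s' 1 v = index v sigma).
Proof.
move=> r2 r5 r7.
pose I i s' := [/\ regs s' 8 = i, regs s' 9 = encode j (drop i sigma) &
  forall a, a < i -> arrays s' 1 (nth 0 sigma a) = a].
pose c0 := Move 8 (Lit 0) ;; Move 9 (Reg 7).
have init : runs w c0 s (cost c0) (I 0).
  by apply: runs_eval => //; rewrite /I /= /upd /= drop0 r7 mod0n.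
have R : runs w invert s (cost c0 + (\sum_(i < m) 4.+1).+1) (I m).
  apply: runs_seq init _ => s1 [u1 a1 h1] I0.
  apply: (@runs_while w _ _ _ _ s1 m (fun=> 4) I)
    => // [i s2 im [u2 a2 h2] [r8 r9 inv]|s2 [u2 _ _] [r8 _ _]];
    last by rewrite /test /= r8 u2 // u1 // r5 ltnn.
  split; first by rewrite /test /= r8 u2 // u1 // r5.
  have is_ : i < size sigma by rewrite size_sigma.
  have bd := blocks_drop i blocks_sigma.
  have sd : 1 <= size (drop i sigma) by rewrite size_drop subn_gt0.
  apply: (@runs_eval w _ s2) => //; rewrite /I /= /upd /= r8 r9 u2 // u1 // r2 lit1.
  rewrite -[binop_val _ Shr _ _]/(_ %/ _) -[binop_val _ ModPow2 _ _]/(_ %% _).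
  rewrite binop_addE ?addn1; last first.
    by apply: word_j; apply: leq_ltn_trans n_lt; apply: ltn_trans m_lt.
  have -> : encode j (drop i sigma) %/ 2 ^ j = encode j (drop i.+1 sigma).
    by rewrite -[X in 2 ^ X]muln1 encode_divn // drop_drop add1n.
  have -> : encode j (drop i sigma) %% 2 ^ j = nth 0 sigma i.
    rewrite -[X in 2 ^ X]muln1 encode_modn // (drop_nth 0 is_) /= take0.
    by rewrite encode_cons encode_nil addn0.
  split=> // a; rewrite ltnS leq_eqVlt => /predU1P [->|ai]; first by rewrite eqxx.
  (* Distinct letters address distinct cells, so earlier entries are preserved. *)
  rewrite nth_uniq ?uniq_sigma ?(ltn_trans ai is_) // (ltn_eqF ai); exact: inv.
apply: runs_weaken R _ _ => [|s' _ [_ _ inv] v vs].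
  by rewrite big_const_ord iter_addn_0 /=; lia.
by rewrite -{1}(nth_index 0 vs) inv // -size_sigma index_mem.
Qed.

End Word.

(** * Processing the levels and summing the cost *)

Lemma size_bfs_le a b : a <= b -> size (bfs Pi a) <= size (bfs Pi b).
Proof.
by move=> ab; rewrite -(subnKC ab) /bfs iotaD map_cat flatten_cat size_cat leq_addr.
Qed.

Lemma mem_bfs m t :
  (t \in bfs Pi m) = [&& 0 < size t <= m, perm_eq t (iota 1 (size t)) & avoids Pi t].
Proof. by rewrite (perm_mem (perm_bfs Pi m)) mem_avoiders_le. Qed.

Lemma blocks_bfs m : m <= n -> all (pos_blocks j) (bfs Pi m).
Proof.
move=> mn; apply/allP=> t; rewrite mem_bfs => /and3P [/andP [_ tm] pt _].
by apply: permutation_blocks pt; apply: leq_ltn_trans n_lt; apply: leq_trans mn.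
Qed.

(* The codes are distinct nonzero words, so their number is itself a word. *)
Lemma word_bfs : size (bfs Pi n) < 2 ^ w.
Proof.
have bn := allP (blocks_bfs (leqnn n)).
rewrite -(size_map (encode j)) -(size_iota 0 (2 ^ w)).
(* The additional element 0 makes the inequality strict. *)
apply: (@uniq_leq_size _ (0 :: map (encode j) (bfs Pi n))) => [|x].
  rewrite /= map_inj_in_uniq; last by move=> x y /bn bx /bn by_; apply: encode_inj.
  rewrite (perm_uniq (perm_bfs Pi n)) avoiders_le_uniq andbT.
  apply/mapP=> -[t]; rewrite mem_bfs => /and3P [/andP [t0 tn] pt _] E.
  have : 0 < encode j t; last by rewrite -E.
  by apply: encode_neq0 pt; rewrite t0 (leq_ltn_trans tn n_lt).
rewrite inE mem_iota add0n /= => /predU1P [->|/mapP [t tb ->]]; first by rewrite expn_gt0.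
apply: word_encode; first by apply: pos_blocksW; apply: bn.
by move: tb; rewrite mem_bfs => /and3P [/andP []].
Qed.

Definition level_state i (s : state) : Prop :=
  [/\ regs s 4 = size (bfs Pi i), regs s 5 = i.+1 & queue (bfs Pi i.+1) s].

Lemma runs_process_level i s :
  i.+1 < n -> regs s 1 = k -> regs s 2 = j -> patterns_listed s -> level_state i s ->
  runs w process_level s (size (level Pi i) * (68 * (n * k)) + 3) (level_state i.+1).
Proof.
move=> i_n r1 r2 ps [r4 r5 qu].
have init : runs w (Move 6 (Reg 3)) s 1 (fun s' => regs s' 6 = size (bfs Pi i.+1)).
  by apply: (@runs_eval w (Move 6 (Reg 3))) => //=; rewrite /upd /=; case: qu.
(* The queue once the first [a] words of level [i] have been expanded. *)
pose Q a := bfs Pi i.+1 ++ flatten [seq children Pi t | t <- take a (level Pi i)].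
pose I a s' := regs s' 4 = size (bfs Pi i) + a /\ queue (Q a) s'.
pose N := size (level Pi i).
pose T (_ : nat) := 1 + (5 * n + 3 + (n * (30 * k + 24) + 3 + 1)).
have R : runs w process_level s (1 + ((\sum_(a < N) (T a).+1).+1 + 1))
    (level_state i.+1).
  apply: runs_seq init _ => s1 [u1 a1 h1] r6.
  apply: (@runs_seq _ _ _ _ _ _ (I N)).
    apply: (@runs_while w _ _ _ _ s1 N T I).
    - rewrite /I /Q take0 cats0 addn0 u1 // r4; split=> //.
      by case: qu => r3 a0 ls; split; rewrite ?u1 ?a1 // => x; rewrite h1 // ls.
    - move=> a s2 aN [u2 a2 h2] [r4' [r3 a0 ls]].
      split; first by rewrite /test /= r4' u2 // r6 bfsS size_cat ltn_add2l.
      set sigma := nth [::] (level Pi i) a.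
      have : sigma \in level Pi i by apply: mem_nth.
      rewrite (perm_mem (perm_level Pi i)) mem_avoiders => /andP [p_sigma av_sigma].
      have read : runs w (Read 7 0 (Reg 4)) s2 1 (fun s' => regs s' 7 = encode j sigma).
        apply: (@runs_eval w (Read 7 0 (Reg 4))) => //=; rewrite /upd /= r4' a0.
          rewrite /Q bfsS -catA nth_cat ltnNge leq_addr /= addKn nth_cat.
          by rewrite -/N aN.
        by rewrite /Q bfsS -catA !size_cat; lia.
      apply: runs_seq read _ => s3 [u3 a3 h3] r7.
      have r2' : regs s3 2 = j by rewrite u3 // u2 // u1.
      have r5' : regs s3 5 = i.+1 by rewrite u3 // u2 // u1.
      apply: runs_seq (runs_invert i_n p_sigma r2' r5' r7) _.
      move=> s4 [u4 a4 h4] inv.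
      have Qsub : {subset Q a.+1 <= bfs Pi i.+2}.
        move=> t; rewrite (bfsS _ i.+1) /Q !mem_cat => /orP [->//|].
        case/flatten_mapP=> u /mem_take ui tu; apply/orP; right.
        by apply/flatten_mapP; exists u.
      have Qsize : size (Q a.+1) < 2 ^ w.
        apply: leq_ltn_trans word_bfs; apply: leq_trans (size_bfs_le i_n).
        rewrite (bfsS _ i.+1) !size_cat leq_add2l /= -{2}(cat_take_drop a.+1 (level Pi i)).
        by rewrite map_cat flatten_cat size_cat leq_addr.
      have QS : Q a.+1 = Q a ++ children Pi sigma.
        by rewrite /Q (take_nth [::]) // map_rcons flatten_rcons catA.
      have Qsub' : {subset Q a <= bfs Pi i.+2}.
        by move=> t ta; apply: Qsub; rewrite QS mem_cat ta.
      have ws4 : word_state i.+1 sigma s4 by split=> //; rewrite ?u4 ?u3 ?u2 ?u1.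
      rewrite QS in Qsize.
      have bQ : all (pos_blocks j) (Q a).
        by apply/allP=> t /Qsub'; apply: (allP (blocks_bfs i_n)).
      have cQ u : perm_eq u (iota 1 i.+1) -> (u \in Q a) = avoids Pi u.
        move=> pu; apply/idP/idP => [/Qsub'|avu].
          by rewrite mem_bfs => /and3P [].
        by rewrite mem_cat mem_bfs (perm_iota_size pu) pu avu leqnn.
      have r7' : regs s4 7 = encode j sigma by rewrite u4.
      have ps4 : patterns_listed s4 by move=> x; rewrite h4 // h3 // h2 // h1 // ps.
      have q4 : queue (Q a) s4.
        split; first by rewrite u4 // u3.
          by move=> b bQa; rewrite a4 // a3 // a0.
        by move=> x; rewrite h4 // h3 // ls.
      apply: runs_seq (runs_expand i_n p_sigma av_sigma bQ cQ Qsize ws4 r7' ps4 q4) _.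
      move=> s5 [u5 a5 h5] q5.
      apply: (@runs_eval w (Op 4 Add (Reg 4) (Lit 1))) => //.
      rewrite /I QS /= /upd /= lit1 u5 // u4 // u3 // r4' binop_addE ?addn1 ?addnS //.
      rewrite -addnS; apply: leq_ltn_trans word_bfs.
      apply: leq_trans (size_bfs_le (ltnW i_n)).
      by rewrite bfsS size_cat leq_add2l.
    - move=> s2 [u2 a2 h2] [r4' _].
      by rewrite /test /= r4' u2 // r6 bfsS size_cat ltnn.
  move=> s2 [u2 a2 h2] [r4' q2].
  apply: (@runs_eval w (Op 5 Add (Reg 5) (Lit 1))) => //; split=> /=; rewrite /upd /=.
  - by rewrite r4' -size_cat -bfsS.
  - rewrite u2 // u1 // r5 lit1 binop_addE addn1 //.
    by apply: word_j; apply: leq_ltn_trans n_lt.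
  - by move: q2; rewrite /Q take_size (bfsS _ i.+1).
apply: runs_weaken R _ _ => //.
rewrite /T big_const_ord iter_addn_0 /= -/N.
(* Since [n] and [k] are positive, [30 * n * k + 29 * n + 9] is at most [(30 + 29 + 9) * n * k]. *)
have le : n * (30 * k + 24) + 5 * n + 9 <= 68 * (n * k) by nia.
by have := leq_mul (leqnn N) le; move: (68 * (n * k)) => X; lia.
Qed.

(** The case [m = 0] of [avoids_ins], where no deletion has to be tested. The empty word avoids [Pi]
    because patterns are nonempty. *)
Lemma avoids_one : avoids Pi [:: 1] = ([:: 1] \notin Pi).
Proof.
have av0 : avoids Pi [::].
  apply/allP=> p /(allP permPi) /andP [p0 _]; apply/negP=> /containsP [u].
  rewrite subseq0 => /eqP -> /order_isoP [sz _]; by rewrite -sz in p0.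
by have /= -> := @avoids_ins Pi 0 0 [::] permPi (perm_refl _) av0; rewrite andbT.
Qed.

Lemma bfs_nil : [:: 1] \in Pi -> bfs Pi n = [::].
Proof.
move=> onePi; have l0 i : level Pi i = [::].
  by elim: i => [|i IH] /=; [rewrite avoids_one onePi | rewrite IH].
by rewrite /bfs; elim: (iota 0 n) => //= i r ->; rewrite l0.
Qed.

(** The maximum with 1 pays for the constant start-up cost when there is no word of length below [n]
    to expand. *)
Lemma runs_generate :
  runs w generate (input_state Pi n j)
    (100 * maxn 1 (size (bfs Pi n.-1) * (n * k)))
    (fun s => output s = map (encode j) (bfs Pi n)).
Proof.
set s := input_state Pi n j; set X := maxn 1 _.
have X0 : 0 < X by rewrite /X; lia.
have ps : patterns_listed s by [].
have e1 : encode j [:: 1] = 1 by rewrite encode_cons encode_nil.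
have init : runs w (Member 3 0 (Lit 1)) s 1 (fun s' => regs s' 3 = ([:: 1] \in Pi)).
  have T1 : tables s 0 (1 %% 2 ^ w) = ([:: 1] \in Pi).
    rewrite lit1 -{1}e1; exact: (@listed_pattern 0 [::] n_gt0 (perm_refl _) 0 s).
  by apply: (@runs_eval w (Member 3 0 (Lit 1))) => //; rewrite -T1.
have step s1 : unchanged (Member 3 0 (Lit 1)) s s1 -> regs s1 3 = ([:: 1] \in Pi) ->
  runs w (If CEq (Reg 3) (Lit 1) (Move 0 (Lit 0)) search) s1 (99 * X)
    (fun s => output s = map (encode j) (bfs Pi n)).
  move=> [u1 a1 h1] r3.
  apply: (@runs_weaken _ _ _ (99 * X).-1.+1 _ _ _ _ _ (fun _ _ q => q)); last by lia.
  apply: runs_if; rewrite /test /= r3 lit1.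
  have [onePi|onePi] := boolP ([:: 1] \in Pi); rewrite /=.
    apply: (@runs_weaken _ _ _ 1 _ (eq (eval w (Move 0 (Lit 0)) s1))); last 2 first.
    - by lia.
    - by move=> _ _ <-; rewrite bfs_nil // /output /= /upd /= mod0n.
    exact: (@runs_eval w (Move 0 (Lit 0))).
  have b1 : bfs Pi 1 = [:: [:: 1]] by rewrite /bfs /= avoids_one onePi.
  have init2 : runs w search_init s1 (cost search_init) (level_state 0).
    apply: runs_eval => //; rewrite /level_state /queue /listed /= /upd /= b1 /=.
    rewrite lit1 mod0n.
    rewrite u1 //; do! split=> //; first by case.
    move=> x; rewrite h1 //= !inE e1; by case: eqP.
  pose T i := size (level Pi i) * (68 * (n * k)) + 3.
  have R : runs w search s1 (cost search_init + ((\sum_(i < n.-1) (T i).+1).+1 + 1))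
      (fun s => output s = map (encode j) (bfs Pi n)).
    apply: runs_seq init2 _ => s2 [u2 a2 h2] ls2.
    apply: (@runs_seq _ _ _ _ _ _ (level_state n.-1)).
      apply: (@runs_while w _ _ _ _ s2 n.-1 T level_state)
        => // [i s3 i_n [u3 a3 h3] ls3|s3 [u3 _ _] [_ r5 _]];
        last by rewrite /test /= r5 u3 // u2 // u1 //= prednK ?ltnn.
      have i_n' : i.+1 < n by lia.
      case: (ls3) => _ r5 _; split; first by rewrite /test /= r5 u3 // u2 // u1.
      apply: runs_process_level => //; rewrite ?u3 ?u2 ?u1 //.
      by move=> x; rewrite h3 // h2 // h1.
    move=> s3 _ [_ _]; rewrite prednK // => -[r3' a0 _].
    apply: (@runs_eval w (Move 0 (Reg 3))) => //; rewrite /output /= /upd /= r3'.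
    rewrite -[RHS](mkseq_nth 0) size_map; apply/eq_in_map => i.
    rewrite mem_iota add0n => /andP [_ i_n].
    by rewrite a0 // (nth_map [::]).
  apply: runs_weaken R _ _ => //.
  have -> : \sum_(i < n.-1) (T i).+1 = size (bfs Pi n.-1) * (68 * (n * k)) + 4 * n.-1.
    rewrite /T; elim: n.-1 => [|m IH]; first by rewrite big_ord0.
    rewrite big_ord_recr /= IH bfsS size_cat mulnDl; lia.
  (* Each level has an overhead of 4 steps even if it is empty. For [n > 1] the word [[:: 1]] is
     expanded, so the main term absorbs this overhead. *)
  have : 4 * n.-1 <= 4 * (size (bfs Pi n.-1) * (n * k)).
    case E: n.-1 => [|n']; first by rewrite muln0.
    have : 0 < size (bfs Pi n'.+1).
      by apply: leq_trans (size_bfs_le (ltn0Sn n')); rewrite b1.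
    move=> S0; rewrite leq_mul2l /=; apply: leq_trans (_ : n * k <= _).
      by apply: leq_trans (leq_pmulr _ k_gt0); rewrite -E leq_pred.
    exact: leq_pmull.
  have : size (bfs Pi n.-1) * (n * k) <= X by apply: leq_maxr.
  rewrite [_ * (68 * _)]mulnCA /=; move: (size _ * _) X X0 => Y X X0; lia.
apply: runs_weaken (runs_seq init step) _ _ => //; lia.
Qed.

End Correctness.

Theorem theorem4p1 :
  exists (P : cmd) (C : nat),
  forall (Pi : seq (seq nat)) (n j w : nat),
    Pi != [::] ->
    all is_permutation Pi ->
    0 < n ->
    maxn n (max_length Pi) < 2 ^ j ->
    maxn n (max_length Pi) * j <= w ->
    exists (t : nat) (s : state),
      [/\ exec w P (input_state Pi n j) t s,
          perm_eq (output s) [seq encode j p | p <- avoiders_le Pi n] &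
          t <= C * maxn 1 (size (avoiders_le Pi n.-1) * (n * max_length Pi))].
Proof.
exists generate, 100 => Pi n j w Pi0 permPi n0 ltj lew.
have k0 : 0 < max_length Pi.
  case: Pi Pi0 permPi {ltj lew} => // p Pi _ /= /andP [/andP [p0 _] _].
  by rewrite /max_length big_cons; apply: leq_trans p0 (leq_maxl _ _).
have [t [s [e le out]]] := runs_generate permPi k0 n0 (conj ltj lew).
exists t, s; split=> //; first by rewrite out; apply/perm_map/perm_bfs.
by rewrite -(perm_size (perm_bfs Pi n.-1)).
Qed.
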